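(* Let $N\ge 2$ and $1\le a\le N-1$ be integers and let $n$ be an integer. Then, as operators on rational functions in $x_1,\dots,x_N$, $$ D^{a,n}_{N}(x_1,\ldots,x_N)=\sum_{i=N-a}^{N}\ \Bigg(\prod_{\substack{j=N-a\\ j\neq i}}^{N}\frac{x_j}{x_j-x_i}\Bigg)\, D^{a,n}_{N-1}(x_1,\ldots,x_{i-1},x_{i+1},\ldots,x_N). $$
   Context: Let $q$ be a formal parameter and $x_1,\dots,x_N$ independent variables. $\Gamma_i$ denotes the $q$-shift operator $(\Gamma_i f)(x_1,\dots,x_N)=f(x_1,\dots,q x_i,\dots,x_N)$ on rational functions. For a set of indices $I$ put $\Gamma_I=\prod_{i\in I}\Gamma_i$ and $x_I=\prod_{i\in I}x_i$. The (time-translated) $q$-Whittaker operator in the variables $(x_1,\dots,x_N)$ is $$ D^{a,n}_{N}(x_1,\ldots,x_N):=\sum_{\substack{I\subset\{1,\dots,N\}\\ |I|=a}}\ \Bigg(\prod_{\substack{i\in I\\ j\in\{1,\dots,N\}\setminus I}}\frac{x_i}{x_i-x_j}\Bigg)(x_I)^n\,\Gamma_I . $$ $D^{a,n}_{N-1}(x_1,\ldots,x_{i-1},x_{i+1},\ldots,x_N)$ is the operator given by the same formula with the index set $\{1,\dots,N\}$ replaced by $\{1,\dots,N\}\setminus\{i\}$: the sum is over $I\subset\{1,\dots,N\}\setminus\{i\}$ with $|I|=a$, and the product is over $k\in I$ and $\ell\in\{1,\dots,N\}\setminus(I\cup\{i\})$. Rational functions act by multiplication. *)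

(* Defs.v *)
From HB Require Import structures.
From mathcomp Require Import all_boot all_order all_algebra.
From mathcomp Require Export fraction generic_quotient.
From mathcomp Require Export mpoly.

Set Implicit Arguments.
Unset Strict Implicit.
Unset Printing Implicit Defensive.

Import GRing.Theory.
Local Open Scope ring_scope.

Notation qfield k := {fraction {poly k}}.
Definition qparam (k : fieldType) : qfield k := FracField.tofrac 'X.

Notation ratfun K N := {fraction {mpoly K[N]}}.

(* 'I_N counts from 0, so the paper's x_(m+1) is the variable of value m; the
   condition N - a <= index reads (N - a <= i.+1)%N. *)
Definition xvar (K : fieldType) (N : nat) (i : 'I_N) : ratfun K N :=
  FracField.tofrac 'X_i.

Definition mpoly_qshift (K : fieldType) (N : nat) (q : K) (i : 'I_N)
    (p : {mpoly K[N]}) : {mpoly K[N]} :=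
  p \mPo [tuple (if j == i then q *: 'X_j else 'X_j : {mpoly K[N]}) | j < N].

(* The shift is applied to the numerator and the denominator of a chosen
   representative; for q != 0 the choice is immaterial, see [qshift_frac]. *)
Definition qshift (K : fieldType) (N : nat) (q : K) (i : 'I_N)
    (f : ratfun K N) : ratfun K N :=
  let u := repr f in
  FracField.tofrac (mpoly_qshift q i \n_u)
  / FracField.tofrac (mpoly_qshift q i \d_u).

(* Composition of the single shifts, which commute when q != 0. *)
Definition qshift_set (K : fieldType) (N : nat) (q : K) (I : {set 'I_N}) :
    ratfun K N -> ratfun K N :=
  \big[comp/id]_(i in I) qshift q i.

(* The operator in the variables x_i with i in S, acting on all rational
   functions of x_1, ..., x_N; [n] may be negative. *)
Definition qWhittaker (K : fieldType) (N : nat) (q : K) (S : {set 'I_N})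
    (a : nat) (n : int) (f : ratfun K N) : ratfun K N :=
  \sum_(I : {set 'I_N} | (I \subset S) && (#|I| == a))
    (\prod_(i in I) \prod_(j in S :\: I)
        (xvar K i / (xvar K i - xvar K j)))
    * (\prod_(i in I) xvar K i) ^ n
    * qshift_set q I f.

Lemma mpoly_qshiftM (K : fieldType) (N : nat) (q : K) (i : 'I_N) :
  {morph mpoly_qshift q i : p r / p * r}.
Proof. by move=> p r; rewrite /mpoly_qshift rmorphM. Qed.

Lemma mpoly_qshiftK (K : fieldType) (N : nat) (q : K) (i : 'I_N) :
  q != 0 -> cancel (mpoly_qshift q i) (mpoly_qshift q^-1 i).
Proof.
move=> q0 p; rewrite /mpoly_qshift {1}(comp_mpolyEX p) [RHS]mpolyE.
set lq := [tuple _ | _ < N].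
rewrite (raddf_sum (comp_mpoly lq)) /=; apply: eq_bigr => m _.
rewrite comp_mpolyZ; congr (_ *: _).
rewrite comp_mpolyX rmorph_prod [RHS]mpolyXE_id /=.
apply: eq_bigr => j _; rewrite rmorphXn; congr (_ ^+ _).
rewrite /= tnth_mktuple; case: ifP => [/eqP ->|ji]; last first.
  by rewrite comp_mpolyXU -tnth_nth tnth_mktuple ji.
rewrite comp_mpolyZ comp_mpolyXU -tnth_nth tnth_mktuple eqxx scalerA.
by rewrite divff // scale1r.
Qed.

Lemma mpoly_qshift_eq0 (K : fieldType) (N : nat) (q : K) (i : 'I_N)
    (p : {mpoly K[N]}) :
  q != 0 -> (mpoly_qshift q i p == 0) = (p == 0).
Proof.
move=> q0; have z (c : K) : mpoly_qshift c i 0 = 0.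
  by rewrite /mpoly_qshift comp_mpoly0.
by apply/eqP/eqP => [h|->//]; rewrite -(mpoly_qshiftK i q0 p) h z.
Qed.

Lemma frac_repr (R : idomainType) (f : {fraction R}) :
  f = FracField.tofrac \n_(repr f) / FracField.tofrac \d_(repr f).
Proof.
have d0 : FracField.tofrac \d_(repr f) != 0 :> {fraction R}.
  by rewrite tofrac_eq0 denom_ratioP.
apply: (mulIf d0); rewrite divfK //.
have e : f = (\pi_({fraction R}) (repr f))%qT by rewrite reprK.
rewrite {1}e; unlock FracField.tofrac.
rewrite -[LHS]FracField.pi_mul; apply/eqmodP => /=.
rewrite FracField.equivfE /FracField.mulf !numden_Ratio ?oner_eq0 //
  ?mulf_neq0 ?oner_eq0 ?denom_ratioP //.
by rewrite !mulr1 mulrC.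
Qed.

Lemma qshift_frac (K : fieldType) (N : nat) (q : K) (i : 'I_N)
    (p r : {mpoly K[N]}) :
  q != 0 -> r != 0 ->
  qshift q i (FracField.tofrac p / FracField.tofrac r)
  = FracField.tofrac (mpoly_qshift q i p)
    / FracField.tofrac (mpoly_qshift q i r).
Proof.
move=> q0 r0; rewrite /qshift /=; set f := FracField.tofrac p / FracField.tofrac r; set u := repr f.
have u0 : \d_u != 0 by exact: denom_ratioP.
have e : \n_u * r = p * \d_u.
  apply/eqP; rewrite -tofrac_eq !tofracM; apply/eqP.
  have h : f = FracField.tofrac \n_u / FracField.tofrac \d_u := frac_repr f.
  by move/eqP: h; rewrite eqr_div ?tofrac_eq0 // => /eqP ->.
have su0 : FracField.tofrac (mpoly_qshift q i \d_u) != 0.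
  by rewrite tofrac_eq0 (mpoly_qshift_eq0 _ _ q0).
have sr0 : FracField.tofrac (mpoly_qshift q i r) != 0.
  by rewrite tofrac_eq0 (mpoly_qshift_eq0 _ _ q0).
apply/eqP; rewrite (eqr_div _ _ su0 sr0).
by rewrite -!tofracM -!mpoly_qshiftM e.
Qed.

Lemma qparam_neq0 (k : fieldType) : qparam k != 0.
Proof. by rewrite tofrac_eq0 polyX_eq0. Qed.

(* Main.v *)
Require Import Defs.
From mathcomp Require Import all_boot all_order all_algebra.

Import GRing.Theory.
Local Open Scope ring_scope.

(** Both sides are combinations of the operators [f |-> x_I^n * Gamma_I f] with
    [#|I| = a], so it suffices to compare the coefficients of each of them.
    The coefficient on the right is a sum over the indices [i] outside [I] in
    [J = {N-a, ..., N}], counting the variables from [1].  Dividing by the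
    coefficient on the left, one has to show

      sum_(i in J) g(x_i) * prod_(j in J, j != i) x_j / (x_j - x_i) = 1,
      where g(z) = prod_(k in I) (1 - z / x_k),

    the indices [i] in [I] having been added for free since then [g(x_i) = 0].
    The product over [j] is the value at [0] of the Lagrange polynomial of the
    node [x_i], so the left side is the value at [0] of the interpolant of [g]
    at the nodes indexed by [J].  As [g] has degree [a < #|J|], it is its own
    interpolant, and [g(0) = 1].

    The same computation applies to every set [J] of more than [a] of the
    variables: [whittaker_coef_expand] compares the coefficients by means of
    [lagrange_interpolation], and [qWhittaker_expand] is the resulting expansion
    of the operator. *)

(** The difference of the two sides vanishes at the [#|J|] nodes and has size
    at most [#|J|]. *)
Lemma lagrange_interpolation (F : fieldType) (T : finType) (J : {set T})
    (x : T -> F) (p : {poly F}) :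
  {in J &, injective x} -> (size p <= #|J|)%N ->
  p = \sum_(i in J)
        p.[x i] *: \prod_(j in J :\ i) ((x i - x j)^-1 *: ('X - (x j)%:P)).
Proof.
move=> x_inj szp; set s := \sum_(i in J) _.
apply/eqP; rewrite -subr_eq0; apply: contraT => ps_neq0.
have szs : (size s <= #|J|)%N.
  apply: (leq_trans (size_sum _ _ _)); apply/bigmax_leqP => i Ji.
  apply: (leq_trans (size_scale_leq _ _)).
  rewrite scaler_prod; apply: (leq_trans (size_scale_leq _ _)).
  by rewrite -big_enum /= size_prod_XsubC -cardE (cardsD1 i J) Ji.
have roots_ps : all (root (p - s)) [seq x i | i <- enum J].
  apply/allP => _ /mapP[i + ->]; rewrite mem_enum => Ji.
  rewrite rootE hornerD hornerN subr_eq0 /s horner_sum (bigD1 i) //=.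
  rewrite hornerZ horner_prod big1 => [|j].
    rewrite mulr1 big1 ?addr0 // => j /andP[Jj ji].
    rewrite hornerZ horner_prod (bigD1 i) /=; last by rewrite !inE eq_sym ji.
    by rewrite hornerZ hornerXsubC subrr mulr0 mul0r mulr0.
  rewrite !inE => /andP[ji Jj]; rewrite hornerZ hornerXsubC mulVf //.
  by rewrite subr_eq0 (inj_in_eq x_inj) // eq_sym.
have uniq_x : uniq [seq x i | i <- enum J].
  rewrite map_inj_in_uniq ?enum_uniq // => i j.
  by rewrite !mem_enum; apply: x_inj.
have := max_poly_roots ps_neq0 roots_ps uniq_x; rewrite size_map -cardE.
rewrite ltnNge (leq_trans (size_polyD _ _)) //.
by rewrite size_polyN geq_max szp szs.
Qed.

(** Dividing by the left side turns this into Lagrange interpolation at [0] of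
    [\prod_(k in I) (1 - z / x k)].  The indices [i] in [I] drop out because the
    polynomial vanishes at [x i]. *)
Lemma whittaker_coef_expand (F : fieldType) (T : finType) (S I J : {set T})
    (x : T -> F) :
  injective x -> (forall i, x i != 0) -> J \subset S -> (#|I| < #|J|)%N ->
  \prod_(k in I) \prod_(l in S :\: I) (x k / (x k - x l)) =
  \sum_(i in J | i \notin I)
    (\prod_(j in J :\ i) (x j / (x j - x i)))
    * \prod_(k in I) \prod_(l in (S :\ i) :\: I) (x k / (x k - x l)).
Proof.
move=> x_inj x_neq0 sJS ltIJ.
set c := LHS.
pose g : {poly F} := \prod_(k in I) (- (x k)^-1 *: ('X - (x k)%:P)).
have gE z : g.[z] = \prod_(k in I) ((x k - z) / x k).
  rewrite /g horner_prod; apply: eq_bigr => k _.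
  by rewrite hornerZ hornerXsubC mulNr -mulrN opprB mulrC.
have szg : (size g <= #|J|)%N.
  rewrite /g scaler_prod; apply: (leq_trans (size_scale_leq _ _)).
  by rewrite -big_enum /= size_prod_XsubC -cardE.
have g0 : g.[0] = 1.
  by rewrite gE big1 // => k _; rewrite subr0 divff.
have interp :
    1 = \sum_(i in J) g.[x i] * \prod_(j in J :\ i) (x j / (x j - x i)).
  apply: (etrans (esym g0)).
  rewrite {1}(lagrange_interpolation _ _ _ _ _ (in2W x_inj) szg) horner_sum.
  apply: eq_bigr => i _; rewrite hornerZ; congr (_ * _); rewrite horner_prod.
  apply: eq_bigr => j _; rewrite hornerZ hornerXsubC sub0r.
  by rewrite -(opprB (x j)) invrN mulrNN mulrC.
rewrite -[c]mulr1 [in LHS]interp (bigID (mem I)) /=.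
rewrite [X in X + _]big1 ?add0r; last first.
  by move=> i /andP[_ Ii]; rewrite gE (bigD1 i) //= subrr !mul0r.
rewrite mulr_sumr; apply: eq_bigr => i /andP[Ji nIi].
rewrite mulrA mulrC; congr (_ * _).
rewrite gE -big_split /=; apply: eq_bigr => k Ik.
(* the factor [l = i] of the full product cancels the factor [k] of [g.[x i]] *)
have xki : x k - x i != 0.
  by rewrite subr_eq0 (inj_eq x_inj); apply: contraNneq nIi => <-.
rewrite (bigD1 i) /=; last by rewrite inE nIi (subsetP sJS).
rewrite mulrAC mulrA divfK // divff // mul1r.
by apply: eq_bigl => l; rewrite !inE; case: (l == i); rewrite ?andbF ?andbT.
Qed.

Lemma xvar_inj (K : fieldType) (N : nat) : injective (@xvar K N).
Proof.
move=> i j /eqP; rewrite tofrac_eq => /eqP.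
move/(congr1 (mcoeff U_(j))); rewrite !mcoeffXU eqxx => /eqP.
by case: (eqVneq i j) => // _; rewrite eq_sym oner_eq0.
Qed.

Lemma xvar_neq0 (K : fieldType) (N : nat) (i : 'I_N) : xvar K i != 0.
Proof.
rewrite tofrac_eq0; apply/eqP => /(congr1 (mcoeff U_(i))) /eqP.
by rewrite mcoeffXU mcoeff0 eqxx oner_eq0.
Qed.

(** The operators on the right run over the subsets of [S :\ i], those on the
    left over the subsets [I] of [S]; exchanging the two sums leaves, for each
    [I], a sum over the [i] outside [I]. *)
Lemma qWhittaker_expand (K : fieldType) (N : nat) (q : K) (S J : {set 'I_N})
    (a : nat) (n : int) (f : ratfun K N) :
  J \subset S -> (a < #|J|)%N ->
  qWhittaker q S a n f =
  \sum_(i in J)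
    (\prod_(j in J :\ i) (xvar K j / (xvar K j - xvar K i)))
    * qWhittaker q (S :\ i) a n f.
Proof.
move=> sJS ltaJ; rewrite /qWhittaker.
under [RHS]eq_bigr => i _ do rewrite mulr_sumr.
rewrite (exchange_big_dep
  (fun I : {set _} => (I \subset S) && (#|I| == a))) /=; last first.
  by move=> i I _ /andP[/subsetD1P[-> _] ->].
apply: eq_bigr => I /andP[sIS /eqP cI].
rewrite (whittaker_coef_expand _ _ S I J) ?cI //; last 2 first.
- exact: xvar_inj.
- exact: xvar_neq0.
rewrite !mulr_suml; apply: eq_big => [i|i _]; last by rewrite !mulrA.
by rewrite subsetD1 sIS eqxx andbT.
Qed.

Theorem theorem2p1 (k : fieldType) (N a : nat) (n : int)
    (hN : (2 <= N)%N) (ha : (1 <= a <= N - 1)%N)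
    (f : ratfun (qfield k) N) :
  qWhittaker (qparam k) [set: 'I_N] a n f =
  \sum_(i < N | (N - a <= i.+1)%N)
    (\prod_(j < N | (N - a <= j.+1)%N && (j != i))
        (xvar (qfield k) j / (xvar (qfield k) j - xvar (qfield k) i)))
    * qWhittaker (qparam k) [set~ i] a n f.
Proof.
pose J := [set i : 'I_N | (N - a <= i.+1)%N].
have ltaJ : (a < #|J|)%N.
  have [_ leaN] := andP ha.
  (* [J] contains the images of [0, ..., a] under [m |-> N - 1 - m] *)
  have ltN (m : 'I_a.+1) : (N - m.+1 < N)%N.
    by rewrite ltn_subrL /= (ltn_trans _ hN).
  have leN (m : 'I_a.+1) : (m.+1 <= N)%N.
    by rewrite (leq_trans (ltn_ord m)) // -(subnK (ltnW hN)) addn1 ltnS.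
  pose h m := Ordinal (ltN m).
  have h_inj : injective h.
    move=> m m' /(congr1 val) /= e; apply/val_inj/succn_inj.
    by rewrite -(subKn (leN m)) e subKn.
  rewrite -[X in (X <= _)%N]card_ord -(card_imset _ h_inj).
  apply/subset_leq_card/subsetP => _ /imsetP[m _ ->].
  by rewrite inE /= -subSn // subSS leq_sub2l // -ltnS.
rewrite (qWhittaker_expand _ _ _ _ J _ _ _ (subsetT J) ltaJ).
apply: eq_big => [i|i _]; first by rewrite inE.
congr (_ * qWhittaker _ _ _ _ _); last by rewrite setTD.
by apply: eq_bigl => j; rewrite !inE andbC.
Qed.
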